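(* Fix the dimension $n\ge 2$. There exists a constant $c_n>0$, depending only on $n$, such that for all $\varepsilon\in(0,1)$, any covering of $H_\varepsilon=[-1+\varepsilon,1-\varepsilon]^n$ by axis-parallel ellipsoids, each contained in $H=[-1,1]^n$, consists of at least $c_n\cdot\left(1+\lfloor\log 1/\varepsilon\rfloor\right)^{n-1}$ ellipsoids.
   Context: An ellipsoid is the image of the Euclidean unit ball under an affine map $x\mapsto Ex+d$ with $E$ non-singular; it is axis-parallel if $E$ can be taken diagonal. Logarithms are base 2. *)

(* Defs.v *)
From HB Require Import structures.
From mathcomp Require Export all_boot all_order all_algebra.
From mathcomp Require Export all_classical all_reals all_analysis.

Set Implicit Arguments.
Unset Strict Implicit.
Unset Printing Implicit Defensive.

Import Order.TTheory GRing.Theory Num.Theory.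

Local Open Scope classical_set_scope.
Local Open Scope ring_scope.

(* The Euclidean norm is written out because the library norm on
   matrices is the sup norm. *)
Definition unit_ball (R : realType) (n : nat) : set 'cV[R]_n :=
  [set x | Num.sqrt (\sum_(i < n) x i 0 ^+ 2) <= 1].
Arguments unit_ball R n _ : clear implicits.

Definition ellipsoid (R : realType) (n : nat) (E : 'M[R]_n) (d : 'cV[R]_n) :
    set 'cV[R]_n :=
  [set E *m x + d | x in unit_ball R n].

Definition axis_parallel_ellipsoid (R : realType) (n : nat)
    (A : set 'cV[R]_n) : Prop :=
  exists (E : 'M[R]_n) (d : 'cV[R]_n),
    [/\ E \in unitmx, is_diag_mx E & A = ellipsoid E d].

Definition cube (R : realType) (n : nat) (a b : R) : set 'cV[R]_n :=
  [set x | forall i : 'I_n, a <= x i 0 <= b].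
Arguments cube {R} n a b _.

Definition log2 (R : realType) (x : R) : R := ln x / ln 2.

(* Main.v *)
Require Import Defs.
From mathcomp Require Import finmap zify ring lra.

Set Implicit Arguments.
Unset Strict Implicit.
Unset Printing Implicit Defensive.

Import Order.TTheory GRing.Theory Num.Theory.

Local Open Scope classical_set_scope.
Local Open Scope ring_scope.

(** Measure points near the corner (1, ..., 1) by y_i = 1 - x_i.  An
    axis-parallel ellipsoid inside the cube with centre d has semi-axes at most
    D_i = 1 - d_i, so each of its points satisfies y_i <= 2 D_i for all i, and
    D_i < 4 y_i for all i but at most one.  Hence, for points with
    y_i = 2^(- k_i), the ellipsoid and the residues k_i mod 3 determine all
    exponents except one.  Taking exponents k in (Z/(N+1))^n with zero sum, where
    N is the floor of log 1/eps, the last exponent is determined as well; so each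
    ellipsoid covers at most n 3^(n-1) of these (N+1)^(n-1) points. *)

Lemma unit_ballE (R : realType) (n : nat) (x : 'cV[R]_n) :
  unit_ball R n x <-> \sum_(i < n) x i 0 ^+ 2 <= 1.
Proof.
by rewrite /unit_ball /= -[X in _ <= X]sqrtr1 ler_sqrt.
Qed.

Lemma diag_mulmx_entry (R : realType) (n : nat) (E : 'M[R]_n) (x : 'cV[R]_n) i :
  is_diag_mx E -> (E *m x) i 0 = E i i * x i 0.
Proof.
move=> /is_diag_mxP dE; rewrite mxE (bigD1 i) //= big1 ?addr0 // => j ji.
by rewrite dE ?mul0r // eq_sym.
Qed.

(** Let w be the preimage of x in the unit ball. Two coordinates with 4 y_i <= D_i would force w_i^2
    and w_j^2 to be at least 9/16, and 9/16 + 9/16 > 1. *)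
Lemma axis_parallel_ellipsoid_corner (R : realType) (n : nat)
    (A : set 'cV[R]_n) :
  axis_parallel_ellipsoid A -> A `<=` cube n (-1) 1 ->
  exists D : 'I_n -> R, forall x, A x ->
    (forall i, 1 - x i 0 <= 2 * D i) /\
    (forall i j, 0 < D i -> 0 < D j ->
       4 * (1 - x i 0) <= D i -> 4 * (1 - x j 0) <= D j -> i = j).
Proof.
move=> [E [d [_ dE ->]]] sub; exists (fun i => 1 - d i 0).
(* The tips d + s E_ii e_i of the ellipsoid, for s = 1 and s = -1, lie in the cube; together they
   bound |E_ii| by D_i. *)
have semiaxis (s : R) i : s ^+ 2 = 1 -> s * E i i <= 1 - d i 0.
  move=> s2; have := sub (E *m (s *: delta_mx i 0) + d).
  have /[swap]/[apply]/(_ i) : ellipsoid E d (E *m (s *: delta_mx i 0) + d).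
    exists (s *: delta_mx i 0) => //; apply/unit_ballE.
    rewrite (bigD1 i) //= big1 ?addr0 ?mxE ?eqxx ?mulr1 ?s2 // => j ji.
    by rewrite !mxE (negPf ji) mulr0 expr0n.
  rewrite mxE diag_mulmx_entry // !mxE !eqxx mulr1 => /andP[_]; lra.
move=> _ [w /unit_ballE w1 <-].
have e1 i : E i i <= 1 - d i 0 by rewrite -[E i i]mul1r semiaxis ?expr1n.
have e2 i : - E i i <= 1 - d i 0.
  by rewrite -[E i i]mul1r -mulNr semiaxis ?sqrrN ?expr1n.
have wle i : w i 0 ^+ 2 <= 1.
  apply: le_trans w1; rewrite (bigD1 i) //= lerDl.
  by apply: sumr_ge0 => k _; exact: sqr_ge0.
have entry k : (E *m w + d) k 0 = E k k * w k 0 + d k 0.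
  by rewrite mxE diag_mulmx_entry.
split=> [i|i j Di Dj].
  rewrite entry.
  have := wle i; have := e1 i; have := e2 i; nra.
rewrite !entry => yi yj.
have big k : 0 < 1 - d k 0 -> 4 * (1 - (E k k * w k 0 + d k 0)) <= 1 - d k 0 ->
    9 / 16 <= w k 0 ^+ 2.
  move=> Dk yk.
  have : 3 * (1 - d k 0) <= 4 * `|w k 0| * (1 - d k 0).
    have : E k k * w k 0 <= (1 - d k 0) * `|w k 0|.
      apply: le_trans (ler_norm _) _; rewrite normrM ler_wpM2r //.
      by rewrite ler_norml e1 andbT lerNl e2.
    nra.
  rewrite ler_pM2r // => wk; rewrite -real_normK ?num_real //; nra.
apply/eqP/negPn/negP => ij.
have := big i Di yi; have := big j Dj yj.
move: w1; rewrite (bigD1 i) //= (bigD1 j) 1?eq_sym //=.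
have : 0 <= \sum_(k < n | (k != i) && (k != j)) w k 0 ^+ 2.
  by apply: sumr_ge0 => k _; exact: sqr_ge0.
lra.
Qed.

(** Both powers lie in (D/4, 2D], so their ratio is below 8 and the exponents differ by less than
    3. *)
Lemma eq_of_mod3_dyadic (R : realType) (D : R) (a b : nat) :
  2 ^- a <= 2 * D -> 2 ^- b <= 2 * D -> D < 4 * 2 ^- a -> D < 4 * 2 ^- b ->
  a = b %[mod 3] -> a = b.
Proof.
wlog ab : a b / (a <= b)%N.
  move=> H; case/orP: (leq_total a b) => ab; first exact: H ab.
  by move=> *; apply/esym/(H b a).
move=> aD _ _ bD abm.
suff : (b < a + 3)%N by move: abm; lia.
rewrite ltnNge; apply/negP => ge3.
have : (2 : R) ^- b <= 2 ^- (a + 3).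
  by rewrite lef_pV2 ?posrE ?exprn_gt0 // ler_weXn2l // ler1n.
rewrite exprD invfM.
have : (2 : R) ^- 3 = 1 / 8 by field.
move=> ->; lra.
Qed.

Section dyadic_points.
Variables (R : realType) (m N : nat).

(** The m values of [g] are placed at the nonzero indices; index 0 takes the value that makes the
    total vanish modulo N + 1. *)
Definition zero_sum (g : {ffun 'I_m -> 'I_N.+1}) (i : 'I_m.+1) : 'I_N.+1 :=
  if unlift ord0 i is Some i' then g i' else - \sum_(i' < m) g i'.

Lemma sum_zero_sum g : \sum_(i < m.+1) zero_sum g i = 0.
Proof.
rewrite big_ord_recl {1}/zero_sum unlift_none.
by rewrite [X in _ + X](eq_bigr g) ?addNr // => i _; rewrite /zero_sum liftK.
Qed.

(** The vanishing sum recovers the entry at [j] from the others, whichever index [j] is. *)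
Lemma zero_sum_inj g h j :
  (forall i, i != j -> zero_sum g i = zero_sum h i) -> g = h.
Proof.
move=> gh.
have ghj : zero_sum g j = zero_sum h j.
  have := etrans (sum_zero_sum g) (esym (sum_zero_sum h)).
  rewrite !(bigD1 j (P := predT)) //=.
  by rewrite (eq_bigr _ gh) => /addIr.
apply/ffunP => i; have : zero_sum g (lift ord0 i) = zero_sum h (lift ord0 i).
  by have [->//|] := eqVneq (lift ord0 i) j; exact: gh.
by rewrite /zero_sum liftK.
Qed.

Definition dyadic_point (g : {ffun 'I_m -> 'I_N.+1}) : 'cV[R]_m.+1 :=
  \col_i (1 - 2 ^- zero_sum g i).

(** Exponents range over 0..N, so eps <= 2^(-N) <= y_i <= 1. *)
Lemma dyadic_point_cube (eps : R) g : 0 < eps < 1 -> eps <= 2 ^- N ->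
  cube m.+1 (-1 + eps) (1 - eps) (dyadic_point g).
Proof.
move=> eps01 epsN i; rewrite mxE.
have : (2 : R) ^- N <= 2 ^- zero_sum g i.
  by rewrite lef_pV2 ?posrE ?exprn_gt0 // ler_weXn2l ?ler1n // -ltnS ltn_ord.
have : (2 : R) ^- zero_sum g i <= 1.
  by rewrite invf_le1 ?exprn_gt0 // exprn_ege1 // ler1n.
lra.
Qed.

Lemma dyadic_cover_card (C : set (set 'cV[R]_m.+1)) : finite_set C ->
  (forall A, C A -> axis_parallel_ellipsoid A /\ A `<=` cube m.+1 (-1) 1) ->
  (forall g, (\bigcup_(A in C) A) (dyadic_point g)) ->
  (N.+1 ^ m <= #|` fset_set C | * (m.+1 * 3 ^ m))%N.
Proof.
move=> finC ellC cov.
have /choice[D DP] : forall A : set 'cV[R]_m.+1, exists D : 'I_m.+1 -> R, C A ->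
    forall x, A x -> (forall i, 1 - x i 0 <= 2 * D i) /\
    (forall i j, 0 < D i -> 0 < D j ->
       4 * (1 - x i 0) <= D i -> 4 * (1 - x j 0) <= D j -> i = j).
  move=> A; have [CA|nCA] := pselect (C A); last by exists (fun=> 0).
  have [ell sub] := ellC A CA.
  by have [D H] := axis_parallel_ellipsoid_corner ell sub; exists D.
have /choice[F FP] : forall g, exists A : fset_set C,
    C (val A) /\ val A (dyadic_point g).
  move=> g; have [A CA Ag] := cov g.
  have AC : A \in fset_set C by rewrite in_fset_set //; exact: mem_set.
  by exists [` AC]%fset.
have dle g i : 2 ^- zero_sum g i <= 2 * D (val (F g)) i.
  have [CF Fg] := FP g; have [/(_ i)] := DP _ CF _ Fg.
  by rewrite mxE opprB addrC subrK.
have Dgt0 g i : 0 < D (val (F g)) i.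
  have := dle g i.
  have : 0 < (2 : R) ^- zero_sum g i by rewrite invr_gt0 exprn_gt0.
  lra.
(* [J g] is the one coordinate where D_i >= 4 y_i may occur; index 0 is the default when there is
   none. *)
have /choice[J JP] : forall g, exists j, forall i, i != j ->
    D (val (F g)) i < 4 * 2 ^- zero_sum g i.
  move=> g; have [CF Fg] := FP g; have [_ uniqD] := DP _ CF _ Fg.
  have [[j Dj]|none] :=
    pselect (exists j, 4 * 2 ^- zero_sum g j <= D (val (F g)) j).
    exists j => i ij; rewrite ltNge; apply/negP => Di.
    case/eqP: ij; apply: uniqD => //; rewrite mxE; lra.
  exists ord0 => i _; rewrite ltNge; apply/negP => Di.
  by apply: none; exists i.
(* The residues are kept only for the m indices other than [J g], enumerated by [lift (J g)]. *)
pose code g : fset_set C * ('I_m.+1 * {ffun 'I_m -> 'I_3}) :=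
  (F g, (J g, [ffun i => inord (zero_sum g (lift (J g) i) %% 3)])).
have code_inj : injective code.
  move=> g h [eqF eqJ /ffunP eqM].
  apply: (@zero_sum_inj _ _ (J g)) => i iJ; apply: val_inj => /=.
  apply: (@eq_of_mod3_dyadic _ (D (val (F g)) i)).
  - exact: dle.
  - by rewrite eqF; exact: dle.
  - exact: JP.
  - by rewrite eqF; apply: JP; rewrite -eqJ.
  - have [i' ->] : exists i', i = lift (J g) i'.
      by case: (unliftP (J g) i) iJ => [i' ->|->]; [exists i'|rewrite eqxx].
    have := eqM i'; rewrite !ffunE -eqJ => /(congr1 val) /=.
    by rewrite !inordK // ltn_pmod.
have := leq_card _ code_inj.
by rewrite !card_prod !card_ffun !card_ord -cardfE.
Qed.

End dyadic_points.

(** As 1/eps > 1, the logarithm is nonnegative and its floor is a natural number N; then N <= log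
    1/eps reads 2^N <= 1/eps. *)
Lemma floor_log2_inv (R : realType) (eps : R) : 0 < eps < 1 ->
  exists2 N : nat, Num.floor (log2 (1 / eps)) = N%:Z & eps <= 2 ^- N.
Proof.
move=> /andP[eps0 eps1].
have ln2 : 0 < ln (2 : R) by rewrite ln_gt0 // ltr1n.
have log0 : 0 <= log2 (1 / eps).
  apply: divr_ge0 (ltW ln2); apply: ln_ge0.
  by rewrite div1r invf_ge1 // ltW.
have fl0 : 0 <= Num.floor (log2 (1 / eps)) by rewrite floor_ge0.
exists `|Num.floor (log2 (1 / eps))|%N; first by rewrite gez0_abs.
set N := `|_|%N.
have : N%:R <= log2 (1 / eps).
  by rewrite -[N%:R]/(N%:Z%:~R) gez0_abs // floor_le.
rewrite /log2 ler_pdivlMr // div1r mulr_natl -lnXn //.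
rewrite ler_ln ?posrE ?exprn_gt0 ?invr_gt0 //.
by move=> H; rewrite -[eps]invrK lef_pV2 ?posrE ?exprn_gt0 ?invr_gt0.
Qed.

Theorem theorem2p4 (R : realType) (n : nat) (hn : (2 <= n)%N) :
  exists c : R, 0 < c /\
    forall eps : R, 0 < eps < 1 ->
    forall C : set (set 'cV[R]_n),
      (forall A, C A -> axis_parallel_ellipsoid A /\ A `<=` cube n (-1) 1) ->
      cube n (-1 + eps) (1 - eps) `<=` \bigcup_(A in C) A ->
      ((c * (1 + Num.floor (log2 (1 / eps)))%:~R ^+ n.-1)%:E <= counting C)%E.
Proof.
case: n hn => // m _.
have K0 : (0 : R) < (m.+1 * 3 ^ m)%:R by rewrite ltr0n muln_gt0 expn_gt0.
(* The inverse of the number of codes per ellipsoid: m + 1 exceptional indices times 3^m residue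
   vectors. *)
exists (m.+1 * 3 ^ m)%:R^-1; split; first by rewrite invr_gt0.
move=> eps eps01 C ellC cov; have [N -> epsN] := floor_log2_inv eps01.
(* An infinite cover has counting measure +oo, so only finite ones remain. *)
rewrite /counting; case: asboolP => finC; last by rewrite leey.
rewrite lee_fin mulrC ler_pdivrMr //= -[(1 + _)%R]/(N.+1%:Z) -natrX -natrM ler_nat.
apply: dyadic_cover_card => // g.
exact/cov/dyadic_point_cube.
Qed.
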